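(* For a torsion theory $(\mathbb C,\mathcal T,\mathcal F)$, the following conditions are equivalent: (a) $(\mathbb C,\mathcal T,\mathcal F)$ is a rectangular torsion theory. (b) $(\mathbb C,\mathcal T,\mathcal F)$ is equivalent to a torsion theory of the form $(\mathbb A\times\mathbb B,\ \mathbb A\times\mathbf 0_{\mathbb B},\ \mathbf 0_{\mathbb A}\times\mathbb B)$, where $\mathbb A$ and $\mathbb B$ are pointed categories. (c) $(\mathbb C,\mathcal T,\mathcal F)$ is equivalent to a product of torsion theories of the form $(\mathbb A,\mathbb A,\mathbf 0_{\mathbb A})$ and $(\mathbb B,\mathbf 0_{\mathbb B},\mathbb B)$.
   Context: A pretorsion theory is a triple $(\mathbb C,\mathcal T,\mathcal F)$ with $\mathbb C$ a category and $\mathcal T,\mathcal F$ full replete (closed under isomorphism) subcategories such that, putting $\mathcal Z=\mathcal T\cap\mathcal F$ and calling a morphism null if it factors through an object of $\mathcal Z$: (T1) every morphism from an object of $\mathcal T$ to an object of $\mathcal F$ is null; (T2) for every object $X$ there is a short exact sequence $T^X\xrightarrow{\ell^X}X\xrightarrow{r^X}F^X$ with $T^X\in\mathcal T$, $F^X\in\mathcal F$. Here a kernel of $f\colon X\to Y$ is a morphism $k\colon K\to X$ with $fk$ null such that every $u$ with $fu$ null factors uniquely through $k$; cokernels are dual; $(\ell,r)$ is short exact if $\ell$ is a kernel of $r$ and $r$ is a cokernel of $\ell$. A choice of short exact sequence for each $X$ is assumed, with $\ell^T=\mathrm{id}_T$ for $T\in\mathcal T$ and $r^F=\mathrm{id}_F$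 for $F\in\mathcal F$. Each $h\colon X\to Y$ induces unique $h^T\colon T^X\to T^Y$, $h^F\colon F^X\to F^Y$ commuting with the $\ell$'s and $r$'s. A pretorsion theory is rectangular if the canonical functor $\Gamma\colon\mathbb C\to\mathcal T\times\mathcal F$, $X\mapsto(T^X,F^X)$, $h\mapsto(h^T,h^F)$, is an equivalence of categories. For a pointed category $\mathbb X$ (one with a zero object), $\mathbf 0_{\mathbb X}$ is the full subcategory of all zero objects. A torsion theory is a pretorsion theory $(\mathbb C,\mathcal T,\mathcal F)$ with $\mathbb C$ pointed and $\mathcal T\cap\mathcal F=\mathbf 0_{\mathbb C}$; a rectangular torsion theory is a torsion theory that is rectangular as a pretorsion theory. The product of $(\mathbb C_1,\mathcal T_1,\mathcal F_1)$ and $(\mathbb C_2,\mathcal T_2,\mathcal F_2)$ is $(\mathbb C_1\times\mathbb C_2,\mathcal T_1\times\mathcal T_2,\mathcal F_1\times\mathcal F_2)$. An equivalence $(\mathbb C,\mathcal T,\mathcal F)\approx(\mathbb D,\mathcal T',\mathcal F')$ is an equivalence of categories $\Lambda\colon\mathbb C\approx\mathbb D:\Lambda'$ preserving (in both directions) torsion objects (those in $\mathcal T$, $\mathcal T'$) and torsion-free objects (those in $\mathcal F$, $\mathcal F'$). *)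

(* Defs.v *)
From Stdlib Require Import IndefiniteDescription.

Set Implicit Arguments.
Unset Strict Implicit.
Unset Printing Implicit Defensive.

Record category := Category {
  Ob :> Type;
  Hom : Ob -> Ob -> Type;
  idm : forall X, Hom X X;
  comp : forall X Y Z, Hom Y Z -> Hom X Y -> Hom X Z;
  compA : forall X Y Z W (h : Hom Z W) (g : Hom Y Z) (f : Hom X Y),
    comp h (comp g f) = comp (comp h g) f;
  comp1m : forall X Y (f : Hom X Y), comp (idm Y) f = f;
  compm1 : forall X Y (f : Hom X Y), comp f (idm X) = f
}.

Arguments Hom {c} X Y.
Arguments idm {c} X.
Arguments comp {c X Y Z} g f.

Notation "g ∘ f" := (comp g f) (at level 40, left associativity).

Definition is_iso (C : category) (X Y : C) (f : Hom X Y) : Prop :=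
  exists g : Hom Y X, g ∘ f = idm X /\ f ∘ g = idm Y.

Definition is_zero (C : category) (Z : C) : Prop :=
  (forall X : C, exists! f : Hom Z X, True) /\
  (forall X : C, exists! f : Hom X Z, True).

Definition pointed (C : category) : Prop := exists Z : C, is_zero Z.

(* A full subcategory is given by a predicate on objects. *)
Definition subcat (C : category) := C -> Prop.

Definition replete (C : category) (S : subcat C) : Prop :=
  forall (X Y : C) (f : Hom X Y), is_iso f -> S X -> S Y.

Definition whole (C : category) : subcat C := fun _ => True.

Definition zeros (C : category) : subcat C := fun X => is_zero X.

Definition full_subcategory (C : category) (S : subcat C) : category.
Proof.
refine (@Category {X : C | S X} (fun X Y => Hom (proj1_sig X) (proj1_sig Y))
          (fun X => idm (proj1_sig X)) (fun X Y Z g f => g ∘ f) _ _ _).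
- intros; apply compA.
- intros; apply comp1m.
- intros; apply compm1.
Defined.

Definition prod_category (C D : category) : category.
Proof.
refine (@Category (C * D)%type
          (fun X Y => (Hom (fst X) (fst Y) * Hom (snd X) (snd Y))%type)
          (fun X => (idm (fst X), idm (snd X)))
          (fun X Y Z g f => (fst g ∘ fst f, snd g ∘ snd f)) _ _ _).
- intros; cbn; f_equal; apply compA.
- intros X Y [f1 f2]; cbn; f_equal; apply comp1m.
- intros X Y [f1 f2]; cbn; f_equal; apply compm1.
Defined.

Definition prod_subcat (C D : category) (S : subcat C) (S' : subcat D) :
    subcat (prod_category C D) :=
  fun X => S (fst X) /\ S' (snd X).

Record functor (C D : category) := Functor {
  fobj :> C -> D;
  fmap : forall X Y : C, Hom X Y -> Hom (fobj X) (fobj Y);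
  fmap1 : forall X : C, fmap (idm X) = idm (fobj X);
  fmapM : forall (X Y Z : C) (g : Hom Y Z) (f : Hom X Y),
    fmap (g ∘ f) = fmap g ∘ fmap f
}.

Arguments fmap {C D} _ {X Y} _.

Definition id_functor (C : category) : functor C C.
Proof.
refine (@Functor C C (fun X => X) (fun X Y f => f) _ _); reflexivity.
Defined.

Definition comp_functor (C D E : category) (G : functor D E) (F : functor C D) :
  functor C E.
Proof.
refine (@Functor C E (fun X => G (F X)) (fun X Y f => fmap G (fmap F f)) _ _).
- intros X; rewrite fmap1; apply fmap1.
- intros X Y Z g f; rewrite fmapM; apply fmapM.
Defined.

Definition naturally_iso (C D : category) (F G : functor C D) : Prop :=
  exists t : forall X : C, Hom (F X) (G X),
    (forall X : C, is_iso (t X)) /\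
    (forall (X Y : C) (f : Hom X Y), t Y ∘ fmap F f = fmap G f ∘ t X).

Definition quasi_inverse (C D : category) (L : functor C D) (L' : functor D C) :
    Prop :=
  naturally_iso (comp_functor L' L) (id_functor C) /\
  naturally_iso (comp_functor L L') (id_functor D).

Definition is_equivalence (C D : category) (L : functor C D) : Prop :=
  exists L' : functor D C, quasi_inverse L L'.

Record triple := Triple {
  carrier :> category;
  tors : subcat carrier;
  tfree : subcat carrier
}.

Arguments tors {t} X.
Arguments tfree {t} X.

Definition null (P : triple) (X Y : P) (f : Hom X Y) : Prop :=
  exists (Z : P) (a : Hom X Z) (b : Hom Z Y),
    tors Z /\ tfree Z /\ f = b ∘ a.

Definition is_kernel (P : triple) (K X Y : P) (k : Hom K X) (f : Hom X Y) :
    Prop :=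
  null (f ∘ k) /\
  forall (U : P) (u : Hom U X), null (f ∘ u) -> exists! v : Hom U K, k ∘ v = u.

Definition is_cokernel (P : triple) (X Y Q : P) (q : Hom Y Q) (f : Hom X Y) :
    Prop :=
  null (q ∘ f) /\
  forall (U : P) (u : Hom Y U), null (u ∘ f) -> exists! v : Hom Q U, v ∘ q = u.

Definition short_exact (P : triple) (A X B : P) (l : Hom A X) (r : Hom X B) :
    Prop :=
  is_kernel l r /\ is_cokernel r l.

Definition pretorsion (P : triple) : Prop :=
  replete (@tors P) /\
  replete (@tfree P) /\
  (forall (X Y : P) (f : Hom X Y), tors X -> tfree Y -> null f) /\
  (forall X : P, exists (A B : P) (l : Hom A X) (r : Hom X B),
     tors A /\ tfree B /\ short_exact l r).

(* The last two fields say that the sequence chosen for X starts (ends) with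
   the identity of X when X is torsion (torsion-free); this includes the
   equality tpart X = X (fpart X = X), so it is an equality of pairs
   (object, morphism). *)
Record ses_choice (P : triple) := SesChoice {
  tpart : P -> P;
  fpart : P -> P;
  ell : forall X, Hom (tpart X) X;
  arr : forall X, Hom X (fpart X);
  tors_tpart : forall X, tors (tpart X);
  tfree_fpart : forall X, tfree (fpart X);
  ses_exact : forall X, short_exact (ell X) (arr X);
  ell_tors : forall X, tors X ->
    existT (fun A => Hom A X) (tpart X) (ell X) =
    existT (fun A => Hom A X) X (idm X);
  arr_tfree : forall X, tfree X ->
    existT (fun B => Hom X B) (fpart X) (arr X) =
    existT (fun B => Hom X B) X (idm X)
}.

Section Gamma.

Variables (P : triple) (HP : pretorsion P) (c : ses_choice P).

Lemma null_middle (X Y : P) (h : Hom X Y) : null (arr c Y ∘ (h ∘ ell c X)).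
Proof.
destruct HP as [_ [_ [T1 _]]].
apply T1; [apply tors_tpart | apply tfree_fpart].
Qed.

Lemma homT_ex (X Y : P) (h : Hom X Y) :
  exists hT : Hom (tpart c X) (tpart c Y), ell c Y ∘ hT = h ∘ ell c X.
Proof.
destruct (ses_exact c Y) as [[_ K] _].
destruct (K _ _ (null_middle h)) as [v [Hv _]].
exists v; exact Hv.
Qed.

Lemma homF_ex (X Y : P) (h : Hom X Y) :
  exists hF : Hom (fpart c X) (fpart c Y), hF ∘ arr c X = arr c Y ∘ h.
Proof.
destruct (ses_exact c X) as [_ [_ K]].
pose proof (null_middle h) as N; rewrite compA in N.
destruct (K _ _ N) as [v [Hv _]].
exists v; exact Hv.
Qed.

Lemma ell_mono (X U : P) (u v : Hom U (tpart c X)) :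
  ell c X ∘ u = ell c X ∘ v -> u = v.
Proof.
intros E; destruct (ses_exact c X) as [[[Z [a [b [HT [HF Eab]]]]] K] _].
assert (N : null (arr c X ∘ (ell c X ∘ v))).
{ exists Z, (a ∘ v), b; repeat split; auto.
  now rewrite compA, Eab, compA. }
destruct (K _ _ N) as [w [_ Uw]].
rewrite <- (Uw u E); exact (Uw v eq_refl).
Qed.

Lemma arr_epi (X U : P) (u v : Hom (fpart c X) U) :
  u ∘ arr c X = v ∘ arr c X -> u = v.
Proof.
intros E; destruct (ses_exact c X) as [_ [[Z [a [b [HT [HF Eab]]]]] K]].
assert (N : null ((v ∘ arr c X) ∘ ell c X)).
{ exists Z, a, (v ∘ b); repeat split; auto.
  now rewrite <- compA, Eab, compA. }
destruct (K _ _ N) as [w [_ Uw]].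
rewrite <- (Uw u E); exact (Uw v eq_refl).
Qed.

(* By ell_mono and arr_epi, homT h and homF h are the unique morphisms
   commuting with the chosen sequences. *)
Definition homT (X Y : P) (h : Hom X Y) : Hom (tpart c X) (tpart c Y) :=
  proj1_sig (constructive_indefinite_description _ (homT_ex h)).

Definition homF (X Y : P) (h : Hom X Y) : Hom (fpart c X) (fpart c Y) :=
  proj1_sig (constructive_indefinite_description _ (homF_ex h)).

Lemma homTE (X Y : P) (h : Hom X Y) : ell c Y ∘ homT h = h ∘ ell c X.
Proof. exact (proj2_sig (constructive_indefinite_description _ (homT_ex h))). Qed.

Lemma homFE (X Y : P) (h : Hom X Y) :
  homF h ∘ arr c X = arr c Y ∘ h.
Proof. exact (proj2_sig (constructive_indefinite_description _ (homF_ex h))). Qed.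

Lemma homT1 (X : P) : homT (idm X) = idm (tpart c X).
Proof. now apply ell_mono; rewrite homTE, comp1m, compm1. Qed.

Lemma homF1 (X : P) : homF (idm X) = idm (fpart c X).
Proof. now apply arr_epi; rewrite homFE, comp1m, compm1. Qed.

Lemma homTM (X Y Z : P) (g : Hom Y Z) (f : Hom X Y) :
  homT (g ∘ f) = homT g ∘ homT f.
Proof.
apply ell_mono; rewrite homTE, compA, homTE.
now rewrite <- !compA, homTE.
Qed.

Lemma homFM (X Y Z : P) (g : Hom Y Z) (f : Hom X Y) :
  homF (g ∘ f) = homF g ∘ homF f.
Proof.
apply arr_epi; rewrite homFE, <- compA, homFE.
now rewrite !compA, homFE.
Qed.

Definition Gamma :
  functor P (prod_category (full_subcategory (@tors P))
                           (full_subcategory (@tfree P))).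
Proof.
refine (@Functor P (prod_category (full_subcategory (@tors P))
                                  (full_subcategory (@tfree P)))
  (fun X => (exist _ (tpart c X) (tors_tpart c X),
             exist _ (fpart c X) (tfree_fpart c X)))
  (fun X Y h => (homT h, homF h)) _ _).
- intros X; cbn; f_equal; [apply homT1 | apply homF1].
- intros X Y Z g f; cbn; f_equal; [apply homTM | apply homFM].
Defined.

End Gamma.

Definition rectangular (P : triple) (c : ses_choice P) : Prop :=
  exists HP : pretorsion P, is_equivalence (Gamma HP c).

Definition torsion (P : triple) : Prop :=
  pretorsion P /\ pointed P /\
  (forall X : P, (tors X /\ tfree X) <-> zeros X).

Definition rectangular_torsion (P : triple) (c : ses_choice P) : Prop :=
  torsion P /\ rectangular c.

Definition prod_triple (P Q : triple) : triple :=
  Triple (prod_subcat (@tors P) (@tors Q)) (prod_subcat (@tfree P) (@tfree Q)).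

Definition equivalent (P Q : triple) : Prop :=
  exists (L : functor P Q) (L' : functor Q P),
    quasi_inverse L L' /\
    (forall X : P, tors X -> tors (L X)) /\
    (forall Y : Q, tors Y -> tors (L' Y)) /\
    (forall X : P, tfree X -> tfree (L X)) /\
    (forall Y : Q, tfree Y -> tfree (L' Y)).

(* Main.v *)
From Stdlib Require Import IndefiniteDescription.
Require Import Defs.

(** The two decompositions are the same thing: the product of the triples
    [(A, A, 0)] and [(B, 0, B)] is [(A × B, A × 0, 0 × B)], and it is a torsion
    theory as soon as [A] and [B] are pointed, because both factors are
    ([torsion_whole_zeros], [torsion_zeros_whole]) and products of torsion
    theories are torsion theories ([torsion_prod]). What remains is that a
    torsion theory is rectangular exactly when it is equivalent to such a
    product.

    If the canonical functor [X ↦ (tpart X, fpart X)] is an equivalence, take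
    for [A] the torsion and for [B] the torsion-free objects. In a torsion
    theory [X] is torsion iff its torsion-free part vanishes, and dually
    ([tors_iff_zero_cokernel]). Hence the canonical functor and its
    quasi-inverse preserve both classes ([equivalent_of_rectangular]).

    Conversely let [L = (L1, L2) : P → A × B] be an equivalence under which
    torsion objects are those with [L2 X] zero and torsion-free objects those
    with [L1 X] zero. By the orthogonality axiom, [ell X] is the coreflection
    of [X] into the torsion objects. In [A × B] the coreflection of [(X1, X2)]
    is [(X1, 0)]; accordingly [L1] inverts [ell X]
    ([coreflection_component_iso]), and dually [L2] inverts [arr X]. Up to
    these isomorphisms the canonical functor is [L] itself, and it inherits
    full faithfulness and essential surjectivity ([Gamma_equivalence]). *)

Set Implicit Arguments.
Unset Strict Implicit.
Unset Printing Implicit Defensive.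

(** * Isomorphisms, zero objects and the opposite category *)

Definition op_category (C : category) : category.
Proof.
refine (@Category C (fun X Y => @Hom C Y X) (fun X => @idm C X)
          (fun X Y Z g f => @comp C Z Y X f g) _ _ _).
- intros; symmetry; apply compA.
- intros; apply compm1.
- intros; apply comp1m.
Defined.

Definition op_functor (C D : category) (F : functor C D) :
  functor (op_category C) (op_category D).
Proof.
refine (@Functor (op_category C) (op_category D) F
          (fun X Y f => @fmap C D F Y X f) _ _).
- intros X; apply (fmap1 F).
- intros X Y Z g f; apply (fmapM F).
Defined.

Definition op_triple (P : triple) : triple :=
  @Triple (op_category P) (@tfree P) (@tors P).

Definition fst_functor (C D : category) : functor (prod_category C D) C.
Proof.
refine (@Functor (prod_category C D) C fst (fun X Y f => fst f) _ _);
  reflexivity.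
Defined.

Definition snd_functor (C D : category) : functor (prod_category C D) D.
Proof.
refine (@Functor (prod_category C D) D snd (fun X Y f => snd f) _ _);
  reflexivity.
Defined.

Lemma is_iso_comp (C : category) (X Y Z : C) (g : Hom Y Z) (f : Hom X Y) :
  is_iso g -> is_iso f -> is_iso (g ∘ f).
Proof.
intros [g' [g'g gg']] [f' [f'f ff']]; exists (f' ∘ g'); split.
- now rewrite compA, <- (compA f'), g'g, compm1.
- now rewrite compA, <- (compA g), ff', compm1.
Qed.

Lemma is_iso_op (C : category) (X Y : C) (f : Hom X Y) :
  @is_iso (op_category C) Y X f -> is_iso f.
Proof. intros [g [gf fg]]; exists g; split; [exact fg | exact gf]. Qed.

Lemma is_iso_pair (C D : category) (X Y : prod_category C D) (f : Hom X Y) :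
  is_iso f <-> is_iso (fst f) /\ is_iso (snd f).
Proof.
destruct f as [f1 f2]; cbn; split.
- intros [[g1 g2] [gf fg]]; cbn in *.
  injection gf as gf1 gf2; injection fg as fg1 fg2.
  now split; [exists g1 | exists g2].
- intros [[g1 [gf1 fg1]] [g2 [gf2 fg2]]]; exists (g1, g2); cbn.
  now rewrite gf1, gf2, fg1, fg2.
Qed.

Lemma is_zero_source (C : category) (Z X : C) (f g : Hom Z X) :
  is_zero Z -> f = g.
Proof.
intros [Z0 _]; destruct (Z0 X) as [w [_ Uw]].
now rewrite <- (Uw f I), <- (Uw g I).
Qed.

Lemma is_zero_target (C : category) (Z X : C) (f g : Hom X Z) :
  is_zero Z -> f = g.
Proof.
intros [_ Z0]; destruct (Z0 X) as [w [_ Uw]].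
now rewrite <- (Uw f I), <- (Uw g I).
Qed.

Lemma is_zero_op (C : category) (Z : C) :
  @is_zero (op_category C) Z <-> is_zero Z.
Proof. split; intros [H1 H2]; split; [exact H2 | exact H1 | exact H2 | exact H1]. Qed.

Lemma pointed_op (C : category) : pointed C -> pointed (op_category C).
Proof. intros [Z HZ]; exists Z; now apply is_zero_op. Qed.

(** Every map into or out of a retract of [Z] extends to one into or out of
    [Z], so uniqueness passes to retracts. *)
Lemma is_zero_retract (C : category) (Z X : C) (p : Hom Z X) (s : Hom X Z) :
  p ∘ s = idm X -> is_zero Z -> is_zero X.
Proof.
intros ps HZ; split; intros U.
- destruct (proj1 HZ U) as [z _]; exists (z ∘ s); split; [exact I | intros f _].
  rewrite <- (compm1 f), <- ps, compA.
  f_equal; now apply is_zero_source.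
- destruct (proj2 HZ U) as [z _]; exists (p ∘ z); split; [exact I | intros f _].
  rewrite <- (comp1m f), <- ps, <- compA.
  f_equal; now apply is_zero_target.
Qed.

Lemma is_zero_iso (C : category) (X Y : C) (f : Hom X Y) :
  is_iso f -> is_zero X -> is_zero Y.
Proof. intros [g [_ fg]]; now apply is_zero_retract with (p := f) (s := g). Qed.

Lemma is_zero_iso_rev (C : category) (X Y : C) (f : Hom X Y) :
  is_iso f -> is_zero Y -> is_zero X.
Proof. intros [g [gf _]]; now apply is_zero_retract with (p := g) (s := f). Qed.

(** The hom-sets of a product are products of hom-sets, and pairing with an
    identity shows that each factor inherits unique existence. *)
Lemma is_zero_pair (C D : category) (X : prod_category C D) :
  is_zero X <-> is_zero (fst X) /\ is_zero (snd X).
Proof.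
destruct X as [X1 X2]; cbn; split.
- intros [Hs Ht]; split; split; intros U.
  + destruct (Hs (U, X2)) as [[w1 w2] [_ Uw]]; exists w1; split; [exact I |].
    intros f _; now injection (Uw (f, idm X2) I).
  + destruct (Ht (U, X2)) as [[w1 w2] [_ Uw]]; exists w1; split; [exact I |].
    intros f _; now injection (Uw (f, idm X2) I).
  + destruct (Hs (X1, U)) as [[w1 w2] [_ Uw]]; exists w2; split; [exact I |].
    intros f _; now injection (Uw (idm X1, f) I).
  + destruct (Ht (X1, U)) as [[w1 w2] [_ Uw]]; exists w2; split; [exact I |].
    intros f _; now injection (Uw (idm X1, f) I).
- intros [H1 H2]; split; intros [U1 U2].
  + destruct (proj1 H1 U1) as [w1 _], (proj1 H2 U2) as [w2 _].
    exists (w1, w2); split; [exact I | intros [f1 f2] _].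
    f_equal; now apply is_zero_source.
  + destruct (proj2 H1 U1) as [w1 _], (proj2 H2 U2) as [w2 _].
    exists (w1, w2); split; [exact I | intros [f1 f2] _].
    f_equal; now apply is_zero_target.
Qed.

(** For the direct implication, a zero object of [C] lying in [S] is zero in the
    subcategory, and all zero objects of the subcategory are isomorphic to it. *)
Lemma is_zero_full (C : category) (S : subcat C) (Z : C) (HZ : is_zero Z)
    (SZ : S Z) (X : full_subcategory S) :
  is_zero X <-> is_zero (proj1_sig X).
Proof.
split.
- intros HX.
  destruct (proj1 HX (exist _ Z SZ)) as [s _].
  destruct (proj1 HZ (proj1_sig X)) as [p _].
  refine (is_zero_retract (p := p) (s := s) _ HZ).
  exact (@is_zero_source (full_subcategory S) X X (p ∘ s) (idm X) HX).
- intros [Hs Ht]; split; intros U; [apply Hs | apply Ht].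
Qed.

(** * Equivalences of categories *)

Definition fully_faithful (C D : category) (F : functor C D) : Prop :=
  forall (X Y : C) (f : Hom (F X) (F Y)), exists! h : Hom X Y, fmap F h = f.

Definition essentially_surjective (C D : category) (F : functor C D) : Prop :=
  forall Y : D, exists (X : C) (e : Hom (F X) Y), is_iso e.

Lemma faithful_of_retract (C D : category) (F : functor C D) (G : functor D C) :
  naturally_iso (comp_functor G F) (id_functor C) ->
  forall (X Y : C) (f g : Hom X Y), fmap F f = fmap F g -> f = g.
Proof.
intros [t [tiso tnat]] X Y f g E.
destruct (tiso X) as [s [_ ts]].
rewrite <- (compm1 f), <- (compm1 g); cbn in ts; rewrite <- ts, !compA.
pose proof (tnat _ _ f) as Nf; pose proof (tnat _ _ g) as Ng; cbn in Nf, Ng.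
now rewrite <- Nf, <- Ng, E.
Qed.

Lemma equivalence_fully_faithful (C D : category) (F : functor C D)
    (G : functor D C) :
  quasi_inverse F G -> fully_faithful F.
Proof.
intros [GF FG] X Y f.
pose proof GF as [t [tiso tnat]].
destruct (tiso X) as [s [st ts]], (tiso Y) as [s' [st' ts']]; cbn in *.
(* The only candidate is the conjugate of [G f]; since [G] is faithful, it is
   enough to compare images under [G]. *)
pose (h := t Y ∘ fmap G f ∘ s).
exists h; split.
- apply (faithful_of_retract FG).
  pose proof (tnat _ _ h) as N; cbn in N.
  apply (f_equal (fun u => s' ∘ u)) in N.
  rewrite compA, st', comp1m in N; rewrite N.
  unfold h; rewrite <- !compA, st, compm1, compA, st'.
  now rewrite comp1m.
- intros h' E; unfold h.
  pose proof (tnat _ _ h') as N; cbn in N.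
  now rewrite <- E, N, <- compA, ts, compm1.
Qed.

(** The axiom of choice selects a preimage of every object and the unique
    preimage of every morphism. *)
Lemma equivalence_of_fully_faithful (C D : category) (F : functor C D) :
  fully_faithful F -> essentially_surjective F -> is_equivalence F.
Proof.
intros ff eso.
assert (faithful : forall (X Y : C) (f g : Hom X Y), fmap F f = fmap F g -> f = g).
{ intros X Y f g E; destruct (ff X Y (fmap F g)) as [h [_ Uh]].
  now rewrite <- (Uh f E), <- (Uh g eq_refl). }
assert (obj : forall Y, {X : C & {e : Hom (F X) Y & {e' : Hom Y (F X) |
                         e' ∘ e = idm (F X) /\ e ∘ e' = idm Y}}}).
{ intros Y.
  destruct (constructive_indefinite_description _ (eso Y)) as [X HX].
  destruct (constructive_indefinite_description _ HX) as [e He].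
  destruct (constructive_indefinite_description _ He) as [e' He'].
  now exists X, e, e'. }
pose (G := fun Y => projT1 (obj Y)).
pose (e := fun Y => projT1 (projT2 (obj Y)) : Hom (F (G Y)) Y).
pose (e' := fun Y => proj1_sig (projT2 (projT2 (obj Y))) : Hom Y (F (G Y))).
assert (e'e : forall Y, e' Y ∘ e Y = idm (F (G Y)))
  by (intros Y; exact (proj1 (proj2_sig (projT2 (projT2 (obj Y)))))).
assert (ee' : forall Y, e Y ∘ e' Y = idm Y)
  by (intros Y; exact (proj2 (proj2_sig (projT2 (projT2 (obj Y)))))).
clearbody e e' G; clear obj.
assert (lift : forall X Y (f : Hom (F X) (F Y)), {h : Hom X Y | fmap F h = f}).
{ intros X Y f; apply constructive_indefinite_description.
  destruct (ff X Y f) as [h [Hh _]]; now exists h. }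
pose (Gm := fun Y Y' (g : Hom Y Y') =>
  proj1_sig (lift (G Y) (G Y') (e' Y' ∘ g ∘ e Y))).
assert (GmE : forall Y Y' (g : Hom Y Y'),
  fmap F (Gm _ _ g) = e' Y' ∘ g ∘ e Y)
  by (intros Y Y' g; exact (proj2_sig (lift (G Y) (G Y') (e' Y' ∘ g ∘ e Y)))).
clearbody Gm.
assert (G1 : forall Y, Gm Y Y (idm Y) = idm (G Y)).
{ intros Y; apply faithful; now rewrite GmE, compm1, fmap1. }
assert (GM : forall X Y Z (g : Hom Y Z) (f : Hom X Y),
  Gm X Z (g ∘ f) = Gm Y Z g ∘ Gm X Y f).
{ intros X Y Z g f; apply faithful; rewrite fmapM, !GmE, !compA.
  now rewrite <- (compA (e' Z ∘ g) (e Y) (e' Y)), ee', compm1. }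
exists (Functor G1 GM); split.
- assert (t : forall X, {t : Hom (G (F X)) X | fmap F t = e (F X)})
    by (intros X; apply lift).
  exists (fun X => proj1_sig (t X)); split; cbn.
  + intros X; destruct (t X) as [u Hu]; cbn.
    destruct (lift _ _ (e' (F X))) as [v Hv].
    exists v; split; apply faithful; rewrite fmapM, fmap1, Hu, Hv;
      [apply e'e | apply ee'].
  + intros X Y f; destruct (t X) as [u Hu], (t Y) as [v Hv]; cbn.
    apply faithful; rewrite !fmapM, GmE, Hu, Hv.
    now rewrite !compA, ee', comp1m.
- exists e; split; cbn.
  + intros Y; exists (e' Y); split; [apply e'e | apply ee'].
  + intros X Y f; rewrite GmE.
    now rewrite !compA, ee', comp1m.
Qed.

(** * Duality and products of torsion theories *)

Lemma null_op (P : triple) (X Y : P) (f : Hom X Y) :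
  @null (op_triple P) Y X f <-> null f.
Proof.
split; intros [Z [a [b [H1 [H2 E]]]]]; exists Z, b, a; repeat split; assumption.
Qed.

Lemma is_kernel_op (P : triple) (K X Y : P) (k : Hom K X) (f : Hom X Y) :
  is_kernel k f -> @is_cokernel (op_triple P) Y X K k f.
Proof.
intros [N U]; split; [now apply null_op |].
intros V u Nu; apply U; now apply null_op.
Qed.

Lemma is_cokernel_op (P : triple) (X Y Q : P) (q : Hom Y Q) (f : Hom X Y) :
  is_cokernel q f -> @is_kernel (op_triple P) Q Y X q f.
Proof.
intros [N U]; split; [now apply null_op |].
intros V u Nu; apply U; now apply null_op.
Qed.

Lemma short_exact_op (P : triple) (A X B : P) (l : Hom A X) (r : Hom X B) :
  short_exact l r -> @short_exact (op_triple P) B X A r l.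
Proof.
intros [K Q]; split; [now apply is_cokernel_op | now apply is_kernel_op].
Qed.

Lemma replete_op (C : category) (S : subcat C) :
  replete S -> @replete (op_category C) S.
Proof.
intros HS X Y f [g [gf fg]] SX.
apply (HS X Y g); [exists f; split; assumption | exact SX].
Qed.

Lemma torsion_op (P : triple) : torsion P -> torsion (op_triple P).
Proof.
intros [[R1 [R2 [T1 T2]]] [HP HZ]]; split; [split; [| split; [| split]] | split].
- now apply replete_op.
- now apply replete_op.
- intros X Y f HX HY; apply null_op; now apply T1.
- intros X; destruct (T2 X) as [A [B [l [r [HA [HB E]]]]]].
  exists B, A, r, l; repeat split; auto; now apply short_exact_op.
- now apply pointed_op.
- intros X; rewrite and_comm; rewrite (HZ X); symmetry; exact (@is_zero_op P X).
Qed.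

Lemma null_pair (P Q : triple) (X Y : prod_triple P Q) (f : Hom X Y) :
  null f <-> null (fst f) /\ null (snd f).
Proof.
destruct f as [f1 f2]; cbn; split.
- intros [[Z1 Z2] [[a1 a2] [[b1 b2] [[T1 T2] [[F1 F2] E]]]]]; cbn in *.
  injection E as E1 E2; split; [exists Z1, a1, b1 | exists Z2, a2, b2]; auto.
- intros [[Z1 [a1 [b1 [T1 [F1 E1]]]]] [Z2 [a2 [b2 [T2 [F2 E2]]]]]].
  exists (Z1, Z2), (a1, a2), (b1, b2); repeat split; auto.
  now cbn; rewrite E1, E2.
Qed.

Lemma is_kernel_pair (P Q : triple) (K1 X1 Y1 : P) (K2 X2 Y2 : Q)
    (k1 : Hom K1 X1) (f1 : Hom X1 Y1) (k2 : Hom K2 X2) (f2 : Hom X2 Y2) :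
  is_kernel k1 f1 -> is_kernel k2 f2 ->
  @is_kernel (prod_triple P Q) (K1, K2) (X1, X2) (Y1, Y2) (k1, k2) (f1, f2).
Proof.
intros [N1 U1] [N2 U2]; split; [now apply null_pair |].
intros [V1 V2] [u1 u2] N; apply null_pair in N; destruct N as [M1 M2]; cbn in *.
destruct (U1 _ _ M1) as [v1 [E1 W1]], (U2 _ _ M2) as [v2 [E2 W2]].
exists (v1, v2); split; cbn; [now rewrite E1, E2 |].
intros [w1 w2] E; injection E as F1 F2.
now rewrite (W1 _ F1), (W2 _ F2).
Qed.

Lemma is_cokernel_pair (P Q : triple) (X1 Y1 C1 : P) (X2 Y2 C2 : Q)
    (q1 : Hom Y1 C1) (f1 : Hom X1 Y1) (q2 : Hom Y2 C2) (f2 : Hom X2 Y2) :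
  is_cokernel q1 f1 -> is_cokernel q2 f2 ->
  @is_cokernel (prod_triple P Q) (X1, X2) (Y1, Y2) (C1, C2) (q1, q2) (f1, f2).
Proof.
intros [N1 U1] [N2 U2]; split; [now apply null_pair |].
intros [V1 V2] [u1 u2] N; apply null_pair in N; destruct N as [M1 M2]; cbn in *.
destruct (U1 _ _ M1) as [v1 [E1 W1]], (U2 _ _ M2) as [v2 [E2 W2]].
exists (v1, v2); split; cbn; [now rewrite E1, E2 |].
intros [w1 w2] E; injection E as F1 F2.
now rewrite (W1 _ F1), (W2 _ F2).
Qed.

Lemma replete_pair (C D : category) (S : subcat C) (S' : subcat D) :
  replete S -> replete S' -> replete (prod_subcat S S').
Proof.
intros R R' X Y f Hf [S1 S2]; apply is_iso_pair in Hf; destruct Hf as [H1 H2].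
split; [exact (R _ _ _ H1 S1) | exact (R' _ _ _ H2 S2)].
Qed.

Lemma torsion_prod (P Q : triple) :
  torsion P -> torsion Q -> torsion (prod_triple P Q).
Proof.
intros [[R1 [R2 [T1 T2]]] [[Z HZ] H0]] [[R1' [R2' [T1' T2']]] [[Z' HZ'] H0']].
split; [split; [| split; [| split]] | split].
- now apply replete_pair.
- now apply replete_pair.
- intros X Y f [] []; apply null_pair; split; [now apply T1 | now apply T1'].
- intros [X X']; destruct (T2 X) as [A [B [l [r [HA [HB [K C]]]]]]].
  destruct (T2' X') as [A' [B' [l' [r' [HA' [HB' [K' C']]]]]]].
  exists (A, A'), (B, B'), (l, l'), (r, r').
  repeat (split; [now split |]); split;
    [now apply is_kernel_pair | now apply is_cokernel_pair].
- exists (Z, Z'); now apply is_zero_pair.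
- intros [X X']; refine (iff_trans _ (iff_sym (is_zero_pair (X, X')))).
  pose proof (H0 X); pose proof (H0' X').
  unfold zeros in *; cbn; unfold prod_subcat; cbn; tauto.
Qed.

(** * Torsion theories with zero torsion or torsion-free part *)

Lemma replete_zeros (C : category) : replete (@zeros C).
Proof. intros X Y f; apply is_zero_iso. Qed.

Lemma null_unique (P : triple) (X Y : P) (f g : Hom X Y) :
  (forall Z : P, tors Z /\ tfree Z -> is_zero Z) -> null f -> null g -> f = g.
Proof.
intros H0 [Z [a [b [TZ [FZ E]]]]] [Z' [a' [b' [TZ' [FZ' E']]]]].
assert (HZ : is_zero Z) by auto; assert (HZ' : is_zero Z') by auto.
destruct (proj1 HZ Z') as [s _]; subst f g.
rewrite <- (is_zero_target (s ∘ a) a' HZ'), compA.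
f_equal; now apply is_zero_source.
Qed.

Lemma torsion_whole_zeros (A : category) :
  pointed A -> torsion (Triple (@whole A) (@zeros A)).
Proof.
intros [Z HZ]; split; [split; [| split; [| split]] | split].
- intros X Y f _ _; exact I.
- apply (@replete_zeros A).
- intros X Y f _ HY; exists Y, f, (idm Y); repeat split; try apply HY.
  now rewrite comp1m.
- intros X; destruct (proj2 HZ X) as [z _].
  assert (Nz : @null (Triple (@whole A) (@zeros A)) X Z z).
  { exists Z, z, (idm Z); repeat split; try apply HZ; now rewrite comp1m. }
  exists X, Z, (idm X), z.
  split; [exact I | split; [exact HZ |]]; split; split; cbn.
  + now rewrite compm1.
  + intros U u _; exists u; split; [apply comp1m |].
    intros v E; now rewrite comp1m in E.
  + now rewrite compm1.
  + intros U u N; rewrite compm1 in N.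
    destruct (proj1 HZ U) as [w _]; exists w; split.
    * refine (null_unique (P := Triple (@whole A) (@zeros A)) _ _ N);
        [now intros Y [_ HY] |].
      exists Z, z, w; now repeat split; try apply HZ.
    * intros w' _; now apply is_zero_source.
- now exists Z.
- intros X; split; [now intros [_ HX] | now intros HX; split].
Qed.

Lemma torsion_zeros_whole (B : category) :
  pointed B -> torsion (Triple (@zeros B) (@whole B)).
Proof.
intros [Z HZ]; split; [split; [| split; [| split]] | split].
- apply (@replete_zeros B).
- intros X Y f _ _; exact I.
- intros X Y f HX _; exists X, (idm X), f; repeat split; try apply HX.
  now rewrite compm1.
- intros X; destruct (proj1 HZ X) as [z _].
  assert (Nz : @null (Triple (@zeros B) (@whole B)) Z X z).
  { exists Z, (idm Z), z; repeat split; try apply HZ; now rewrite compm1. }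
  exists Z, X, z, (idm X).
  split; [exact HZ | split; [exact I |]]; split; split; cbn.
  + now rewrite comp1m.
  + intros U u N; rewrite comp1m in N.
    destruct (proj2 HZ U) as [w _]; exists w; split.
    * refine (null_unique (P := Triple (@zeros B) (@whole B)) _ _ N);
        [now intros Y [HY _] |].
      exists Z, w, z; now repeat split; try apply HZ.
    * intros w' _; now apply is_zero_target.
  + now rewrite comp1m.
  + intros U u _; exists u; split; [apply compm1 |].
    intros v E; now rewrite compm1 in E.
- now exists Z.
- intros X; split; [now intros [HX _] | now intros HX; split].
Qed.

(** If [X] is torsion then [r] is both epi and, by orthogonality, null, which
    makes [B] zero; if [B] is zero then the identity of [X] factors through
    the mono [l], which is thereby invertible. *)
Lemma tors_iff_zero_cokernel (P : triple) (A X B : P) (l : Hom A X)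
    (r : Hom X B) :
  torsion P -> tors A -> tfree B -> short_exact l r ->
  tors X <-> is_zero B.
Proof.
intros [[R1 [_ [T1 _]]] [_ H0]] HA HB [[Nl Kl] [_ Cr]]; split.
- (* [r] factors through a zero object [Z], of which [B] is then a retract:
     [b ∘ s] and the identity of [B] agree after precomposition with [r]. *)
  intros HX; destruct (T1 _ _ r HX HB) as [Z [a [b [TZ [FZ E]]]]].
  assert (HZ : is_zero Z) by (apply H0; auto).
  destruct (proj2 HZ B) as [s _].
  refine (is_zero_retract (p := b) (s := s) _ HZ).
  destruct (Cr _ _ Nl) as [w [_ Uw]].
  rewrite <- (Uw (b ∘ s)), <- (Uw (idm B)); [reflexivity | apply comp1m |].
  rewrite E, <- compA; f_equal; now apply is_zero_target.
- intros HB0.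
  assert (N : forall U (u : Hom U B), null u).
  { intros U u; exists B, u, (idm B).
    destruct (proj2 (H0 B) HB0); repeat split; auto; now rewrite comp1m. }
  destruct (Kl _ (idm X) (N _ _)) as [v [lv _]].
  apply (R1 A X l); [exists v; split; [| exact lv] | exact HA].
  destruct (Kl _ l (N _ _)) as [w [_ Uw]].
  rewrite <- (Uw (v ∘ l)), <- (Uw (idm A)); [reflexivity | apply compm1 |].
  now rewrite compA, lv, comp1m.
Qed.

Lemma tfree_iff_zero_kernel (P : triple) (A X B : P) (l : Hom A X)
    (r : Hom X B) :
  torsion P -> tors A -> tfree B -> short_exact l r ->
  tfree X <-> is_zero A.
Proof.
intros HP HA HB E; rewrite <- is_zero_op.
exact (tors_iff_zero_cokernel (P := op_triple P) (torsion_op HP) HB HA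
         (short_exact_op E)).
Qed.

(** * The canonical functor of a rectangular theory preserves both classes *)

Lemma equivalent_of_rectangular (P : triple) (HP : torsion P)
    (c : ses_choice P) :
  rectangular c ->
  equivalent P
    (prod_triple
       (Triple (@whole (full_subcategory (@tors P))) (@zeros _))
       (Triple (@zeros (full_subcategory (@tfree P))) (@whole _))).
Proof.
intros [HP' [L' qi]].
pose proof HP as [_ [[Z HZ] H0]].
destruct (proj2 (H0 Z) HZ) as [TZ FZ].
assert (torsE : forall X : P, tors X <-> is_zero (fpart c X))
  by (intros X; exact (tors_iff_zero_cokernel HP (tors_tpart c X)
                         (tfree_fpart c X) (ses_exact c X))).
assert (tfreeE : forall X : P, tfree X <-> is_zero (tpart c X))
  by (intros X; exact (tfree_iff_zero_kernel HP (tors_tpart c X)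
                         (tfree_fpart c X) (ses_exact c X))).
exists (Gamma HP' c), L'; split; [exact qi |].
destruct qi as [_ [t [tiso _]]].
split; [| split; [| split]].
- intros X HX; split; [exact I |].
  apply (is_zero_full HZ FZ); now apply torsE.
- intros Y [_ HY]; apply torsE.
  destruct (proj1 (is_iso_pair _) (tiso Y)) as [_ Hiso].
  exact (proj1 (is_zero_full HZ FZ _) (is_zero_iso_rev Hiso HY)).
- intros X HX; split; [| exact I].
  apply (is_zero_full HZ TZ); now apply tfreeE.
- intros Y [HY _]; apply tfreeE.
  destruct (proj1 (is_iso_pair _) (tiso Y)) as [Hiso _].
  exact (proj1 (is_zero_full HZ TZ _) (is_zero_iso_rev Hiso HY)).
Qed.

(** * Rectangularity from a product decomposition *)

(** Full faithfulness and essential surjectivity of the functor into the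
    product, phrased through its two components: in this form the conditions
    are symmetric in [L1] and [L2] and stable under passing to opposites,
    whereas the opposite of a product category is not literally the product of
    the opposites. *)
Definition jointly_fully_faithful (C A B : category)
    (L1 : functor C A) (L2 : functor C B) : Prop :=
  forall (X Y : C) (f : Hom (L1 X) (L1 Y)) (g : Hom (L2 X) (L2 Y)),
    exists! h : Hom X Y, fmap L1 h = f /\ fmap L2 h = g.

Definition jointly_surjective (C A B : category)
    (L1 : functor C A) (L2 : functor C B) : Prop :=
  forall (a : A) (b : B), exists (X : C) (f : Hom (L1 X) a) (g : Hom (L2 X) b),
    is_iso f /\ is_iso g.

Lemma jointly_faithful (C A B : category) (L1 : functor C A) (L2 : functor C B)
    (X Y : C) (h h' : Hom X Y) :
  jointly_fully_faithful L1 L2 ->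
  fmap L1 h = fmap L1 h' -> fmap L2 h = fmap L2 h' -> h = h'.
Proof.
intros ff E1 E2; destruct (ff X Y (fmap L1 h') (fmap L2 h')) as [w [_ Uw]].
rewrite <- (Uw h), <- (Uw h'); auto.
Qed.

Lemma jointly_reflect_iso (C A B : category) (L1 : functor C A)
    (L2 : functor C B) (X Y : C) (f : Hom (L1 X) (L1 Y))
    (g : Hom (L2 X) (L2 Y)) :
  jointly_fully_faithful L1 L2 -> is_iso f -> is_iso g ->
  exists h : Hom X Y, is_iso h.
Proof.
intros ff [f' [f'f ff']] [g' [g'g gg']].
destruct (ff X Y f g) as [h [[h1 h2] _]].
destruct (ff Y X f' g') as [k [[k1 k2] _]].
exists h, k; split; apply (jointly_faithful ff); rewrite fmapM, fmap1;
  congruence.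
Qed.

(** The coreflection of [X = (X1, X2)] into the objects with zero second
    component should be [(X1, 0)]. An object [W] lying over [(X1, 0)] maps to
    [X], and factoring this map through [l] gives a right inverse of [L1 l];
    it is a left inverse because [l] is mono. *)
Lemma coreflection_component_iso (C A B : category) (L1 : functor C A)
    (L2 : functor C B) (T X : C) (l : Hom T X) :
  jointly_fully_faithful L1 L2 -> jointly_surjective L1 L2 -> pointed B ->
  is_zero (L2 T) ->
  (forall (W : C) (w : Hom W X), is_zero (L2 W) ->
     exists! v : Hom W T, l ∘ v = w) ->
  is_iso (fmap L1 l).
Proof.
intros ff eso [Z HZ] HT univ.
destruct (eso (L1 X) Z) as [W [f [g [Hf Hg]]]].
pose proof (is_zero_iso_rev Hg HZ) as HW.
destruct (proj1 HW (L2 X)) as [z _].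
destruct (ff W X f z) as [w [[w1 _] _]].
destruct (univ W w HW) as [v [lv _]].
destruct Hf as [f' [_ ff']].
(* [t] is the image under [L1] of the map [(X1, 0) → T] induced by
   [(id, 0) : (X1, 0) → X]. *)
pose (t := fmap L1 v ∘ f').
assert (lt : fmap L1 l ∘ t = idm (L1 X))
  by (unfold t; now rewrite compA, <- fmapM, lv, w1).
exists t; split; [| exact lt].
destruct (ff T T (t ∘ fmap L1 l) (idm (L2 T))) as [e [[e1 _] _]].
assert (le : l ∘ e = l).
{ apply (jointly_faithful ff).
  - now rewrite fmapM, e1, compA, lt, comp1m.
  - now apply is_zero_source. }
destruct (univ T l HT) as [u [_ Uu]].
now rewrite <- e1, <- (Uu e le), (Uu (idm T) (compm1 l)), fmap1.
Qed.

Lemma reflection_component_iso (C A B : category) (L1 : functor C A)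
    (L2 : functor C B) (X F : C) (r : Hom X F) :
  jointly_fully_faithful L1 L2 -> jointly_surjective L1 L2 -> pointed A ->
  is_zero (L1 F) ->
  (forall (W : C) (w : Hom X W), is_zero (L1 W) ->
     exists! v : Hom F W, v ∘ r = w) ->
  is_iso (fmap L2 r).
Proof.
intros ff eso HA HF univ; apply is_iso_op.
apply (@coreflection_component_iso (op_category C) (op_category B)
         (op_category A) (op_functor L2) (op_functor L1) F X r).
- intros U V f g; destruct (ff V U g f) as [h [[h1 h2] Uh]].
  exists h; split; [now split |].
  intros k [k1 k2]; now apply Uh.
- intros b a; destruct (eso a b) as [W [f [g [[f' [f'f ff']] [g' [g'g gg']]]]]].
  exists W, g', f'; split; [now exists g | now exists f].
- now apply pointed_op.
- now apply is_zero_op.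
- intros W w HW; apply univ; now apply is_zero_op.
Qed.

(** By the two lemmas above, [L1 X] and [L2 X] are the first component of the
    torsion part and the second component of the torsion-free part of [X],
    while the remaining components of these parts vanish; so a pair of
    morphisms (or objects) between such parts is the same as a pair of
    morphisms (or objects) in [A] and [B]. *)
Lemma Gamma_equivalence (P : triple) (HP : pretorsion P) (c : ses_choice P)
    (A B : category) (L1 : functor P A) (L2 : functor P B) :
  jointly_fully_faithful L1 L2 -> jointly_surjective L1 L2 ->
  pointed A -> pointed B ->
  (forall X : P, tors X <-> is_zero (L2 X)) ->
  (forall X : P, tfree X <-> is_zero (L1 X)) ->
  is_equivalence (Gamma HP c).
Proof.
intros ff eso HA HB torsE tfreeE.
pose proof HP as [_ [_ [T1 _]]].
assert (tpart0 : forall X, is_zero (L2 (tpart c X)))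
  by (intros X; apply torsE, tors_tpart).
assert (fpart0 : forall X, is_zero (L1 (fpart c X)))
  by (intros X; apply tfreeE, tfree_fpart).
assert (l_iso : forall X, is_iso (fmap L1 (ell c X))).
{ intros X; apply (coreflection_component_iso ff eso HB (tpart0 X)).
  intros W w HW; destruct (ses_exact c X) as [[_ K] _]; apply K.
  apply T1; [now apply torsE | apply tfree_fpart]. }
assert (r_iso : forall X, is_iso (fmap L2 (arr c X))).
{ intros X; apply (reflection_component_iso ff eso HA (fpart0 X)).
  intros W w HW; destruct (ses_exact c X) as [_ [_ K]]; apply K.
  apply T1; [apply tors_tpart | now apply tfreeE]. }
apply equivalence_of_fully_faithful.
- (* The squares with [ell] and [arr] determine [L1 h] from [u] and [L2 h]
     from [v]. *)
  intros X Y [u v]; cbn in u, v.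
  destruct (l_iso X) as [lX [lXl llX]], (r_iso Y) as [rY [rYr rrY]].
  destruct (ff X Y (fmap L1 (ell c Y) ∘ fmap L1 u ∘ lX)
                   (rY ∘ fmap L2 v ∘ fmap L2 (arr c X)))
    as [h [[h1 h2] Uh]].
  exists h; split.
  + cbn; f_equal.
    * apply (ell_mono (c := c)); rewrite homTE.
      apply (jointly_faithful ff); [| now apply is_zero_source].
      now rewrite !fmapM, h1, <- compA, lXl, compm1.
    * apply (arr_epi (c := c)); rewrite homFE.
      apply (jointly_faithful ff); [now apply is_zero_target |].
      now rewrite !fmapM, h2, !compA, rrY, comp1m.
  + intros k E; cbn in E; injection E as Eu Ev; subst u v.
    apply Uh; split.
    * now rewrite <- fmapM, homTE, fmapM, <- compA, llX, compm1.
    * now rewrite <- compA, <- fmapM, homFE, fmapM, compA, rYr, comp1m.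
- intros [[T HT] [F HF]].
  destruct (eso (L1 T) (L2 F)) as [X [f [g [Hf Hg]]]].
  apply torsE in HT as HT0; apply tfreeE in HF as HF0.
  assert (zero_iso : forall (C : category) (U V : C), is_zero U -> is_zero V ->
    exists z : Hom U V, is_iso z).
  { intros C U V HU HV.
    destruct (proj1 HU V) as [z _], (proj1 HV U) as [z' _].
    exists z, z'; split; now apply is_zero_source. }
  (* [L1] of the torsion part of [X] is [L1 X], hence [L1 T], and [L2] vanishes
     on both; dually for [F]. *)
  destruct (zero_iso _ _ _ (tpart0 X) HT0) as [z Hz].
  destruct (zero_iso _ _ _ (fpart0 X) HF0) as [z' Hz'].
  destruct (r_iso X) as [rX [rXr rrX]].
  assert (HrX : is_iso rX) by now exists (fmap L2 (arr c X)).
  destruct (jointly_reflect_iso ff (is_iso_comp Hf (l_iso X)) Hz) as [p Hp].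
  destruct (jointly_reflect_iso ff Hz' (is_iso_comp Hg HrX)) as [q Hq].
  exists X.
  exists ((p, q) : @Hom (prod_category (full_subcategory (@tors P))
                          (full_subcategory (@tfree P)))
            (Gamma HP c X) (exist _ T HT, exist _ F HF)).
  apply is_iso_pair; split; [exact Hp | exact Hq].
Qed.

Lemma rectangular_of_equivalent (P : triple) (HP : pretorsion P)
    (c : ses_choice P) (A B : category) :
  pointed A -> pointed B ->
  equivalent P (prod_triple (Triple (@whole A) (@zeros A))
                            (Triple (@zeros B) (@whole B))) ->
  rectangular c.
Proof.
intros HA HB [L [L' [qi [LT [LT' [LF LF']]]]]]; exists HP.
pose proof HP as [R1 [R2 _]].
pose proof (equivalence_fully_faithful qi) as ff.
destruct qi as [[t [tiso _]] [s [siso _]]].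
apply (Gamma_equivalence HP c
         (L1 := comp_functor (fst_functor A B) L)
         (L2 := comp_functor (snd_functor A B) L)); auto; cbn.
- intros X Y f g; destruct (ff X Y (f, g)) as [h [Eh Uh]].
  exists h; split; [exact (conj (f_equal fst Eh) (f_equal snd Eh)) |].
  intros k [E1 E2]; exact (Uh k (injective_projections _ (f, g) E1 E2)).
- intros a b; exists (L' (a, b)), (fst (s (a, b))), (snd (s (a, b))).
  exact (proj1 (is_iso_pair _) (siso (a, b))).
- intros X; split; [intros HX; apply (LT X HX) |].
  intros H; apply (R1 _ _ (t X) (tiso X)), LT'; now split.
- intros X; split; [intros HX; apply (LF X HX) |].
  intros H; apply (R2 _ _ (t X) (tiso X)), LF'; now split.
Qed.

Theorem theorem3p3 (P : triple) (HP : torsion P) (c : ses_choice P) :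
  (rectangular_torsion c <->
   exists A B : category,
     pointed A /\ pointed B /\
     torsion (Triple (prod_subcat (@whole A) (@zeros B))
                     (prod_subcat (@zeros A) (@whole B))) /\
     equivalent P (Triple (prod_subcat (@whole A) (@zeros B))
                          (prod_subcat (@zeros A) (@whole B))))
  /\
  (rectangular_torsion c <->
   exists A B : category,
     torsion (Triple (@whole A) (@zeros A)) /\
     torsion (Triple (@zeros B) (@whole B)) /\
     equivalent P (prod_triple (Triple (@whole A) (@zeros A))
                               (Triple (@zeros B) (@whole B)))).
Proof.
assert (ab : rectangular_torsion c -> exists A B : category,
  pointed A /\ pointed B /\
  equivalent P (prod_triple (Triple (@whole A) (@zeros A))
                            (Triple (@zeros B) (@whole B)))).
{ intros [_ rect]; pose proof HP as [_ [[Z HZ] H0]].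
  destruct (proj2 (H0 Z) HZ) as [TZ FZ].
  exists (full_subcategory (@tors P)), (full_subcategory (@tfree P)).
  split; [| split]; [| | exact (equivalent_of_rectangular HP rect)].
  - exists (exist _ Z TZ); now apply (is_zero_full HZ TZ).
  - exists (exist _ Z FZ); now apply (is_zero_full HZ FZ). }
assert (ba : forall A B : category, pointed A -> pointed B ->
  equivalent P (prod_triple (Triple (@whole A) (@zeros A))
                            (Triple (@zeros B) (@whole B))) ->
  rectangular_torsion c).
{ intros A B HA HB E; split; [exact HP |].
  exact (rectangular_of_equivalent (proj1 HP) c HA HB E). }
(* The triples of the two decompositions are convertible, so [ab] and [ba]
   serve for both. *)
split; split.
- intros H; destruct (ab H) as [A [B [HA [HB E]]]].
  exists A, B; repeat (split; [assumption |]); split; [| exact E].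
  exact (torsion_prod (torsion_whole_zeros HA) (torsion_zeros_whole HB)).
- intros [A [B [HA [HB [_ E]]]]]; exact (ba A B HA HB E).
- intros H; destruct (ab H) as [A [B [HA [HB E]]]].
  exists A, B; split; [| split]; [| | exact E].
  + now apply torsion_whole_zeros.
  + now apply torsion_zeros_whole.
- intros [A [B [HA [HB E]]]]; apply (ba A B); [apply HA | apply HB | exact E].
Qed.
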